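(* Assume that: (i) $U$ is a compact subset of a Polish space $(\mathcal U,d_{\mathcal U})$; (ii) $f=(\mathrm{id},\hat f):\mathbb R^n\times U\to T\mathbb R^n$, $f(x,u)=(x,\hat f(x,u))$, is Lipschitz continuous, i.e. there is $L_f>0$ with $d_{T\mathbb R^n}(f(x,u_1),f(y,u_2))\le L_f(\|x-y\|_{\mathbb R^n}+d_{\mathcal U}(u_1,u_2))$ for all $x,y\in\mathbb R^n$, $u_1,u_2\in U$; (iii) for every $x\in\mathbb R^n$ the set $F(x)=\{\hat f(x,u):u\in U\}$ is convex. Let $V:\mathcal P(\mathbb R^n)\to\mathcal P(T\mathbb R^n)$ be a measure vector field associated with the control system $\dot x=f(x,u)$, $u\in U$, such that $V$ maps $\mathcal P_c(\mathbb R^n)$ to $\mathcal P_c(T\mathbb R^n)$. Then, for every $R>0$, there exists a measure control $\tilde u$ such that $V[\mu]=V^{\tilde u}[\mu]$ for every $\mu\in\mathcal P_c(\mathbb R^n)$ with $\operatorname{spt}(\mu)\subset B(0,R)$.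
   Context: $T\mathbb R^n$ is identified with $\mathbb R^n\times\mathbb R^n$ (pairs $(x,v)$, base point and velocity), with $d_{T\mathbb R^n}$ the Euclidean distance on $\mathbb R^{2n}$. For a Polish space $X$, $\mathcal P(X)$ is the set of Borel probability measures on $X$, $\mathcal P_c(X)$ the subset of those with compact support, $\operatorname{spt}(\mu)$ the support of $\mu$, and $\phi_{\#}\mu$ the pushforward of $\mu$ under a Borel map $\phi$. $B(0,R)$ is the ball of center $0$ and radius $R$ in $\mathbb R^n$. $\pi_1$ denotes the projection onto the first ($\mathbb R^n$) component, on both $T\mathbb R^n$ and $\mathbb R^n\times U$. A measure vector field is a map $V:\mathcal P(\mathbb R^n)\to\mathcal P(T\mathbb R^n)$ with $(\pi_1)_{\#}V[\mu]=\mu$ for every $\mu\in\mathcal P(\mathbb R^n)$. It is associated with the control system $\dot x=f(x,u)$, $u\in U$, if $\operatorname{spt}(V[\mu])\subset\{(x,v)\in T\mathbb R^n: v\in F(x)\}$ for every $\mu\in\mathcal P(\mathbb R^n)$. A measure control is a map $\tilde u:\mathcal P(\mathbb R^n)\to\mathcal P(\mathbb R^n\times U)$ with $(\pi_1)_{\#}(\tilde u[\mu])=\mu$ for every $\mu\in\mathcal P(\mathbb R^n)$. The measure vector field associated with $\tilde u$ and the control system is $V^{\tilde u}[\mu]=f_{\#}(\tilde u[\mu])$. *)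

(* Defs.v *)
From HB Require Import structures.
From mathcomp Require Import all_boot all_order all_algebra.
From mathcomp Require Import all_classical all_reals all_analysis.

Set Implicit Arguments.
Unset Strict Implicit.
Unset Printing Implicit Defensive.

Import Order.TTheory GRing.Theory Num.Theory.
Import numFieldTopology.Exports.

Local Open Scope classical_set_scope.
Local Open Scope ring_scope.

(** ** Borel probability measures on an arbitrary topological space *)

(* A [measurableType] has to be pointed, whereas the subtype of a set (such as
   the control set) has no canonical point.  A space carrying a probability
   measure is nonempty, so a point is packed together with the measure; it is
   never used, since measures are only compared by [eq_borel] below. *)
Definition pointed_at (X : choiceType) (x0 : X) : Type := X.

HB.instance Definition _ (X : choiceType) (x0 : X) :=
  Choice.on (pointed_at x0).
HB.instance Definition _ (X : choiceType) (x0 : X) :=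
  isPointed.Build (pointed_at x0) x0.

Definition borelType (X : topologicalType) (x0 : X) :=
  @g_sigma_algebraType (pointed_at x0) (@open X).

Record borel_probability (R : realType) (X : topologicalType) :=
  BorelProbability {
    bp_point : X ;
    bp_measure : probability (borelType bp_point) R }.

Definition bp_fun (R : realType) (X : topologicalType)
    (mu : borel_probability R X) : set X -> \bar R := bp_measure mu.

Coercion bp_fun : borel_probability >-> Funclass.

(* The library's measures are total functions on [set X] whose values off the
   sigma-algebra are irrelevant, so equality of measures is equality on the
   Borel sets. *)
Definition eq_borel (R : realType) (X : topologicalType)
    (m1 m2 : set X -> \bar R) : Prop :=
  forall A : set X, <<s @open X >> A -> m1 A = m2 A.

Notation "m1 =b m2" := (eq_borel m1 m2) (at level 70, no associativity).

(* For [F] to be a map between sets of measures, it must be compatible with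
   equality of measures. *)
Definition measure_map (R : realType) (X Y : topologicalType)
    (F : borel_probability R X -> borel_probability R Y) : Prop :=
  forall mu nu : borel_probability R X, mu =b nu -> F mu =b F nu.

Definition push (R : realType) (X Y : topologicalType) (phi : X -> Y)
    (mu : borel_probability R X) : set Y -> \bar R :=
  @pushforward _ _ (borelType (bp_point mu)) (borelType (phi (bp_point mu))) R
    (bp_measure mu) phi.

Definition spt (R : realType) (X : topologicalType)
    (mu : borel_probability R X) : set X :=
  [set x | forall A : set X, open A -> A x -> (0 < mu A)%E].

Definition compactly_supported (R : realType) (X : topologicalType)
    (mu : borel_probability R X) : Prop := compact (spt mu).

(** ** Polish spaces *)

#[short(type="completeMetricType")]
HB.structure Definition CompleteMetric (R : numDomainType) :=
  { T of Complete T & Metric R T }.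

Definition separable (X : topologicalType) : Prop :=
  exists2 D : set X, countable D & dense D.

(** ** Euclidean structures on R^n and TR^n *)

(* The library's norm on ['rV[R]_n] is the sup norm. *)
Definition enorm (R : realType) (n : nat) (x : 'rV[R]_n) : R :=
  Num.sqrt (\sum_(i < n) x ord0 i ^+ 2).

Definition tangent (R : realType) (n : nat) : topologicalType :=
  ('rV[R]_n * 'rV[R]_n)%type.

Definition dist_tangent (R : realType) (n : nat) (p q : tangent R n) : R :=
  enorm (row_mx p.1 p.2 - row_mx q.1 q.2).

Definition cball0 (R : realType) (n : nat) (r : R) : set 'rV[R]_n :=
  [set x | enorm x <= r].

Arguments cball0 {R} n r.

(** ** Control systems, measure vector fields and measure controls *)

Section control_system.
Context (R : realType) (n : nat) (T : completeMetricType R) (U : set T).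

(* [U], used as a type, is the subtype [{u : T | u \in U}] with the induced
   topology. *)
Definition dynamics (fhat : 'rV[R]_n -> U -> 'rV[R]_n) :
    'rV[R]_n * U -> tangent R n :=
  fun p => (p.1, fhat p.1 p.2).

Definition lipschitz_dynamics (fhat : 'rV[R]_n -> U -> 'rV[R]_n) : Prop :=
  exists2 L : R, 0 < L &
    forall (x y : 'rV[R]_n) (u1 u2 : U),
      dist_tangent (dynamics fhat (x, u1)) (dynamics fhat (y, u2))
        <= L * (enorm (x - y) + mdist (\val u1) (\val u2)).

Definition velocities (fhat : 'rV[R]_n -> U -> 'rV[R]_n) (x : 'rV[R]_n) :
    set 'rV[R]_n := range (fhat x).

Definition measure_vector_field
    (V : borel_probability R 'rV[R]_n -> borel_probability R (tangent R n)) :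
    Prop :=
  measure_map V /\ forall mu, push fst (V mu) =b mu.

Definition associated_with (fhat : 'rV[R]_n -> U -> 'rV[R]_n)
    (V : borel_probability R 'rV[R]_n -> borel_probability R (tangent R n)) :
    Prop :=
  forall mu, spt (V mu) `<=` [set p | velocities fhat p.1 p.2].

Definition measure_control
    (u : borel_probability R 'rV[R]_n ->
         borel_probability R ('rV[R]_n * U)%type) : Prop :=
  measure_map u /\ forall mu, push fst (u mu) =b mu.

Definition control_vector_field (fhat : 'rV[R]_n -> U -> 'rV[R]_n)
    (u : borel_probability R 'rV[R]_n ->
         borel_probability R ('rV[R]_n * U)%type)
    (mu : borel_probability R 'rV[R]_n) : set (tangent R n) -> \bar R :=
  push (dynamics fhat) (u mu).

End control_system.

(* Main.v *)
Require Import Defs.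
From HB Require Import structures.
From mathcomp Require Import all_boot all_order all_algebra.
From mathcomp Require Import all_classical all_reals all_analysis.

Set Implicit Arguments.
Unset Strict Implicit.
Unset Printing Implicit Defensive.

Import Order.TTheory GRing.Theory Num.Theory.
Import numFieldTopology.Exports.

Local Open Scope classical_set_scope.
Local Open Scope ring_scope.

(** Every velocity in the support of [V mu] is attained by some control, so the
    required measure control only has to choose one, in a Borel way: if [phi]
    is a Borel map with [fhat x (phi (x, v)) = v] for every [(x, v)] in the
    graph [G] of [F], then [u mu], the image of [V mu] under
    [(x, v) |-> (x, phi (x, v))], has first marginal [mu], and its image under
    the dynamics is [V mu], because the composite of the two maps is the
    identity on [G].

    Two facts carry the argument.

    - [V mu] is concentrated on [G] ([spt_conull], [eq_measure_spt]).  The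
      complement of the support of a Borel measure on a space with a countable
      basis is a countable union of null open sets, and [G] is closed.

    - [phi] exists ([closed_borel_uniformization]).  The relation
      [fhat x u = v] is closed and [u] ranges over a compact second countable
      space.  Fix a countable basis of open sets and let [C_k] be their
      complements.  Starting from the compact fiber over [(x, v)], intersect
      successively with each [C_k], unless this would give the empty set.  By
      compactness a point survives all steps, and any surviving point may be
      taken for [phi (x, v)]: whether it lies in [C_k] is decided at step [k],
      by the condition that the set reached there meets [C_k].  Conditions of
      this kind are Borel in [(x, v)], because the projection of a closed set
      along a compact space is closed; so the preimage under [phi] of every
      basic open set is Borel.

    The same [phi] serves all [mu] at once, so the choice respects equality of
    measures. *)

(** * Second countability *)

Lemma second_countable_seq (X : topologicalType) :
  @second_countable X ->
  exists2 O : nat -> set X, (forall k, open (O k)) &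
    forall (x : X) (A : set X), nbhs x A -> exists2 k, O k x & O k `<=` A.
Proof.
move=> [B /pfcard_geP[->|[f]] [Bo Bn]].
  exists (fun=> set0) => [k|x A xA]; first exact: open0.
  by have [? []] := Bn x A xA.
exists f => [k|x A xA]; first by apply: Bo; exact: funS.
have [C [BC Cx] CA] := Bn x A xA.
by have [k _ fk] := @surj _ _ _ _ f _ BC; exists k; rewrite fk.
Qed.

(** The interiors of the balls of radius [1 / (N + 1)] centered at the points
    of a countable dense set form a basis. *)
Lemma separable_second_countable (R : realType) (X : pseudoMetricType R) :
  separable X -> @second_countable X.
Proof.
move=> [D cD dD].
pose b (p : X * nat) : set X := (ball p.1 p.2.+1%:R^-1)°.
exists (b @` (D `*` setT)).
  by apply: card_le_trans (card_image_le _ _) _; exact: countableX.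
split=> [_ [p _ <-]|x A /nbhs_ballP[_/posnumP[e] eA]].
  exact: open_interior.
have [//|N] := @ltr_add_invr R 0%R (e%:num / 2) _; rewrite add0r => Ne.
pose r : {posnum R} := PosNum (ltr0Sn R N).
(* The center is taken within half the radius of [x], so that [x] lies in the
   interior of the ball around it. *)
have [|y [/interior_subset yx Dy]] :=
    dD (ball x (r%:num^-1 / 2))° _ (@open_interior _ _).
  by exists x; apply: nbhsx_ballx.
exists (b (y, N)); first split; first by exists (y, N).
  apply/nbhs_ballP; exists (r%:num^-1 / 2) => //= z xz.
  by rewrite [_^-1]splitr; apply: ball_triangle xz; exact: ball_sym.
move=> z /interior_subset/= yz; apply: eA; rewrite [e%:num]splitr.
apply: (@ball_triangle _ _ y); apply: (le_ball (ltW Ne)) => //.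
by apply: le_ball yx; rewrite ler_pdivrMr// ler_peMr// ler1n.
Qed.

Lemma second_countable_set_type (X : topologicalType) (A : set X) :
  @second_countable X -> @second_countable A.
Proof.
move=> [B cB [Bo Bn]]; exists ((fun C => set_val @^-1` C) @` B).
  exact: card_le_trans (card_image_le _ _) cB.
split=> [_ [C BC <-]|x N [_ [[W oW <-]] /= Wx WN]].
  by exists C => //; exact: Bo.
have [C [BC Cx] CW] := Bn _ _ (open_nbhs_nbhs (conj oW Wx)).
by exists (set_val @^-1` C) => [|y /CW/WN //]; split=> //; exists C.
Qed.

Lemma separable_prod (X Y : topologicalType) :
  separable X -> separable Y -> separable (X * Y)%type.
Proof.
move=> [C cC dC] [D cD dD]; exists (C `*` D); first exact: countableX.
move=> A [[x y] Axy] oA.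
have [[P Q] [/= Px Qy] PQ] : nbhs (x, y) A by exact: open_nbhs_nbhs.
have [|u [Pu Cu]] := dC P° _ (@open_interior _ _); first by exists x.
have [|v [Qv Dv]] := dD Q° _ (@open_interior _ _); first by exists y.
by exists (u, v); split=> //; apply: PQ; split; exact: interior_subset.
Qed.

Lemma separable_rV (R : realType) (n : nat) : separable 'rV[R]_n.
Proof.
exists (range (map_mx (@ratr R) : 'rV[rat]_n -> 'rV[R]_n)).
  exact: card_le_trans (card_image_le _ _) (countableP _).
move=> A [x Ax] oA.
have /nbhs_ballP[e /= e0 eA] : nbhs x A by exact: open_nbhs_nbhs.
have q i : exists q : rat, ball (x ord0 i) e (ratr q).
  have [|_ [/[swap] -[q _ <-] bq]] :=
      @dense_rat R (ball (x ord0 i) e) _ (ball_open _ _).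
    by exists (x ord0 i); exact: ballxx.
  by exists q.
exists (map_mx ratr (\row_i sval (cid (q i)))); split; last by eexists.
apply: eA; split=> // i j; rewrite !mxE (ord1 i); exact: svalP (cid (q j)).
Qed.

Lemma second_countable_tangent (R : realType) (n : nat) :
  @second_countable (tangent R n).
Proof.
apply: (@separable_second_countable R ('rV[R]_n * 'rV[R]_n)%type).
by apply: separable_prod; exact: separable_rV.
Qed.

(** * Compactness and closed relations *)

Lemma compact_set_type (X : topologicalType) (A : set X) :
  compact A -> compact [set: A].
Proof.
move=> cA F PF _.
have [|x [Ax clx]] := cA (fmap (set_val : A -> X) F) (fmap_proper_filter _ PF).
  by apply: (@filterS _ F _ setT) filterT => u _; exact: set_valP.
exists (exist _ x (mem_set Ax)); split=> // B N FB [_ [[W oW <-]] /= Wx WN].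
have [|_ [[u Bu <-] Wu]] :=
  clx ((set_val : A -> X) @` B) W _ (open_nbhs_nbhs (conj oW Wx)).
  by apply: (@filterS _ F _ B) FB => u Bu; exists u.
by exists u; split=> //; exact: WN.
Qed.

(** The tube lemma: the complement of the projection is open because a
    neighborhood of [{z} `*` Y] contains a tube when [Y] is compact. *)
Lemma closed_fst_image (Z Y : topologicalType) (D : set (Z * Y)) :
  compact [set: Y] -> closed D -> closed (fst @` D).
Proof.
move=> /compact_near_coveringP cY cD; rewrite -openC openE => z nDz.
have cov := cY Z (nbhs z) (fun z' y => ~ D (z', y)) _.
have {}cov : \forall z' \near z, [set: Y] `<=` (fun y => ~ D (z', y)).
  apply: cov => y _.
  have : nbhs (z, y) (~` D).
    apply: open_nbhs_nbhs; split; first exact: closed_openC.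
    by move=> Dzy; apply: nDz; exists (z, y).
  case=> -[P Q] [/= Pz Qy] PQ; exists (Q, P) => //.
  by move=> [y' z'] /= [Qy' Pz']; apply: (PQ (z', y')).
apply: filterS cov => z' nD [[z'' y] Dzy /= z'E].
by apply: (nD y) => //; rewrite -z'E.
Qed.

Lemma closed_eq_fun (X Z : topologicalType) (f g : X -> Z) :
  hausdorff_space Z -> continuous f -> continuous g ->
  closed [set x | f x = g x].
Proof.
move=> hZ cf cg; rewrite -openC openE => x /= /eqP fgx.
move: hZ; rewrite open_hausdorff => /(_ _ _ fgx).
move=> [[P Q] /= [/set_mem Pf /set_mem Qg] [oP oQ /eqP PQ]].
near=> y => /= fgy.
have : (P `&` Q) (f y).
  split; first by near: y; apply: cf; exact: open_nbhs_nbhs.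
  by rewrite fgy; near: y; apply: cg; exact: open_nbhs_nbhs.
by rewrite PQ.
Unshelve. all: by end_near. Qed.

Lemma continuous_fst_pair (X Y Z : topologicalType) (h : X * Y -> Z) :
  continuous h -> continuous (fun p => (p.1, h p)).
Proof. by move=> ch p; apply: cvg_pair; [exact: cvg_fst|exact: ch]. Qed.

(** The incidence relation between pairs (base point, velocity) and controls,
    as a closed set.  It is stated for abstract spaces; for the control system
    [X] and [Z] are both the Euclidean space. *)
Lemma closed_fiber (X Y Z : topologicalType) (h : X -> Y -> Z) :
  hausdorff_space Z -> continuous (fun p => h p.1 p.2) ->
  closed [set q : (X * Z) * Y | h q.1.1 q.2 = q.1.2].
Proof.
move=> hZ ch.
apply: (@closed_eq_fun _ _ (fun q : X * Z * Y => h q.1.1 q.2)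
  (fun q => q.1.2)) => // q.
  apply: (@continuous_comp _ _ _ (fun q : X * Z * Y => (q.1.1, q.2))
    (fun p => h p.1 p.2)); last exact: ch.
  apply: cvg_pair; last exact: cvg_snd.
  by apply: (@continuous_comp _ _ _ fst fst); exact: cvg_fst.
by apply: (@continuous_comp _ _ _ fst snd); [exact: cvg_fst|exact: cvg_snd].
Qed.

(** * Measurable selection *)

(** The selection is built from a multifunction [K] with closed values in a
    compact space and from a countable basis [O].  The measurability hypothesis
    bears on all closed sets [B], and not only on the complements [C k], so
    that it passes from each trimmed multifunction to the next. *)
Section selection.
Context {d : measure_display} {P : measurableType d} {Y : topologicalType}.
Variables (K : P -> set Y) (O : nat -> set Y) (y0 : Y).
Hypotheses (cptY : compact [set: Y]) (Oo : forall k, open (O k)).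
Hypothesis Ob :
  forall (y : Y) (A : set Y), nbhs y A -> exists2 k, O k y & O k `<=` A.
Hypothesis closedK : forall p, closed (K p).
Hypothesis measurableK :
  forall B, closed B -> measurable [set p | K p `&` B !=set0].

Let C k := ~` O k.

Let cC k : closed (C k). Proof. exact: open_closedC. Qed.

Fixpoint trimmed k (p : P) : set Y :=
  if k is k'.+1 then
    if `[< trimmed k' p `&` C k' !=set0 >] then trimmed k' p `&` C k'
    else trimmed k' p
  else K p.

Let closed_trimmed k p : closed (trimmed k p).
Proof. by elim: k => //= k IH; case: ifP => // _; exact: closedI. Qed.

Let trimmed_subset k m p : (k <= m)%N -> trimmed m p `<=` trimmed k p.
Proof.
move=> /subnK <-; elim: (m - k)%N => // j; apply: subset_trans.
by rewrite addSn /=; case: ifP => _ y => [[]|].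
Qed.

Let trimmed_neq0 k p : K p !=set0 -> trimmed k p !=set0.
Proof. by move=> K0; elim: k => //= k IH; case: ifPn => // /asboolP. Qed.

(** Step [k] depends on whether [trimmed k p] meets [C k]; in either case the
    question whether the new set meets [B] is one on [trimmed k p] and a closed
    set, [C k `&` B] or [B]. *)
Let measurable_trimmed k B :
  closed B -> measurable [set p | trimmed k p `&` B !=set0].
Proof.
elim: k B => [|k IH] B cB /=; first exact: measurableK.
have -> : [set p | trimmed k.+1 p `&` B !=set0] =
    [set p | trimmed k p `&` (C k `&` B) !=set0] `|`
    (~` [set p | trimmed k p `&` C k !=set0] `&`
     [set p | trimmed k p `&` B !=set0]).
  apply/seteqP; split=> p /=; case: asboolP => h.
  - by rewrite setIA; left.
  - by move=> ?; right.
  - by rewrite setIA => -[//|[]].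
  - by case=> [[y [ty [Cy _]]]|[]//]; exfalso; apply: h; exists y.
apply: measurableU; first by apply: IH; exact: closedI.
by apply: measurableI; [apply: measurableC|]; exact: IH.
Qed.

(** The trimmed sets form a filter base in a compact space, and being closed
    they contain its cluster points. *)
Let trimmed_cap p : K p !=set0 -> \bigcap_k trimmed k p !=set0.
Proof.
move=> K0.
pose F : set_system Y := filter_from setT (trimmed^~ p).
have PF : ProperFilter F.
  apply: filter_from_proper => [|k _]; last exact: trimmed_neq0.
  apply: filter_from_filter; first by exists 0.
  move=> i j _ _; exists (maxn i j) => //.
  rewrite subsetI; split; apply: trimmed_subset.
    exact: leq_maxl.
  exact: leq_maxr.
have [y [_ Fy]] := cptY PF filterT.
exists y => k _; apply: (@closed_trimmed k p).
by move=> N yN; apply: Fy yN; exists k.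
Qed.

Definition selection (p : P) : Y := xget y0 (\bigcap_k trimmed k p).

Let selection_trimmed k p : K p !=set0 -> trimmed k p (selection p).
Proof. by move=> /trimmed_cap/(xgetPex y0); apply. Qed.

Lemma selectionP p : K p !=set0 -> K p (selection p).
Proof. exact: (@selection_trimmed 0). Qed.

(** If [trimmed k p] meets [C k] then the next trimmed set is included in
    [C k], hence so is the selected point; conversely the selected point itself
    witnesses that they meet.  Where [K p] is empty the selection is the
    constant [y0]. *)
Let measurable_selection_basis k : measurable (selection @^-1` C k).
Proof.
have mK : measurable [set p | K p !=set0].
  rewrite [X in measurable X](_ : _ = [set p | K p `&` setT !=set0]).
    by apply: measurableK; exact: closedT.
  by apply/seteqP; split=> p /=; rewrite setIT.
have -> : selection @^-1` C k =
    [set p | trimmed k p `&` C k !=set0] `|`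
    (~` [set p | K p !=set0] `&` (if `[< C k y0 >] then setT else set0)).
  apply/seteqP; split=> p /=.
    have [K0 Cp|K0] := pselect (K p !=set0).
      by left; exists (selection p); split=> //; exact: selection_trimmed.
    rewrite /selection xgetPN => [Cy0|y Ky]; last first.
      by apply: K0; exists y; exact: (Ky 0).
    by right; split=> //; case: asboolP.
  have sub k' p' : trimmed k' p' `<=` K p' by apply: (@trimmed_subset 0).
  case=> [tC|[K0]].
    have K0 : K p !=set0 by case: tC => y [/sub ty _]; exists y.
    have /= := @selection_trimmed k.+1 p K0.
    by case: asboolP => // _ [].
  case: asboolP => // Cy0 _; rewrite /selection xgetPN// => y Ky.
  by apply: K0; exists y; exact: (Ky 0).
apply: measurableU; first by apply: measurable_trimmed.
by apply: measurableI; [exact: measurableC|case: ifP].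
Qed.

Lemma measurable_selection A : open A -> measurable (selection @^-1` A).
Proof.
move=> oA.
have -> : selection @^-1` A =
    \bigcup_(k in [set k | O k `<=` A]) (~` (selection @^-1` C k)).
  apply/seteqP; split=> p /=.
    move=> Ap; have [k Ok kA] := Ob (open_nbhs_nbhs (conj oA Ap)).
    by exists k => //= /(_ Ok).
  by case=> k /= kA nC; apply: kA; exact: contrapT.
by apply: bigcup_measurable => k _; apply: measurableC.
Qed.

End selection.

(** * Borel measures *)

Lemma open_measurable_borelType (X : topologicalType) (x0 : X) (A : set X) :
  open A -> @measurable _ (borelType x0) A.
Proof. exact: sub_sigma_algebra. Qed.

Lemma closed_measurable_borelType (X : topologicalType) (x0 : X) (A : set X) :
  closed A -> @measurable _ (borelType x0) A.
Proof.
move=> cA; rewrite -[A]setCK; apply: measurableC.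
by apply: open_measurable_borelType; exact: closed_openC.
Qed.

Lemma measurable_borelP d (P : measurableType d) (X : topologicalType)
    (x0 : X) (g : P -> X) :
  (forall A, open A -> measurable (g @^-1` A)) ->
  measurable_fun setT (g : P -> borelType x0).
Proof.
move=> mg; apply: (@measurability _ _ P (borelType x0) setT g (@open X)) => //.
by move=> _ [A oA <-]; rewrite setTI; exact: mg.
Qed.

(** [W] is the union over the countable basis [O] of the rectangles
    [G k `*` O k], with [G k] the largest open set for which the rectangle is
    included in [W]. *)
Lemma measurable_pair_preimage d (P : measurableType d) (X Y : topologicalType)
    (g : P -> X) (h : P -> Y) :
  @second_countable Y ->
  (forall A, open A -> measurable (g @^-1` A)) ->
  (forall A, open A -> measurable (h @^-1` A)) ->
  forall W : set (X * Y), open W -> measurable ((fun p => (g p, h p)) @^-1` W).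
Proof.
move=> /second_countable_seq[ O Oo Ob] mg mh W oW.
pose G k := interior [set x | forall y, O k y -> W (x, y)].
have -> : (fun p => (g p, h p)) @^-1` W =
    \bigcup_k (g @^-1` G k `&` h @^-1` O k).
  apply/seteqP; split=> p /=; last first.
    by case=> k _ [/interior_subset/= Gp Op]; exact: Gp.
  move=> Wp; have [[A B] [/= Ax By] AB] : nbhs (g p, h p) W.
    exact: open_nbhs_nbhs.
  have [k Ok kB] := Ob _ _ By; exists k => //; split=> //=.
  by apply: filterS Ax => x Ax y /kB By'; exact: AB.
apply: bigcupT_measurable => k.
by apply: measurableI; [apply: mg; exact: open_interior|exact: mh].
Qed.

(** Each point off the support has a null basic neighborhood, and there are
    countably many of those. *)
Lemma spt_conull (R : realType) (X : topologicalType)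
    (mu : borel_probability R X) (A : set X) :
  @second_countable X -> <<s @open X >> A -> spt mu `<=` A ->
  mu (~` A) = 0%E.
Proof.
move=> /second_countable_seq[ O Oo Ob] mA sA.
apply: (@measure_negligible _ _ _ (bp_measure mu)); first exact: measurableC.
pose N k := if mu (O k) == 0%E then O k else set0.
apply: (@negligibleS _ (borelType (bp_point mu)) R _ (\bigcup_k N k)); last first.
  apply: negligible_bigcup => k; rewrite /N; case: eqP => [Ok0|_].
    by apply/negligibleP => //; exact: open_measurable_borelType.
  exact: negligible_set0.
move=> x nAx; have /existsNP[B /not_implyP[oB /not_implyP[Bx /negP muB]]] :
  ~ spt mu x by move=> /sA.
have [k Okx kB] := Ob _ _ (open_nbhs_nbhs (conj oB Bx)).
exists k => //; rewrite /N ifT// -measure_le0 (le_trans _ (_ : mu B <= 0)%E)//.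
  by apply: le_measure; rewrite ?inE//; exact: open_measurable_borelType.
by rewrite leNgt.
Qed.

Lemma spt_neq0 (R : realType) (X : topologicalType)
    (mu : borel_probability R X) : @second_countable X -> spt mu !=set0.
Proof.
move=> sX; apply/set0P/eqP => s0.
have := @spt_conull R X mu set0 sX.
rewrite setC0 s0 /bp_fun probability_setT => /(_ _ _)/eqP.
by rewrite onee_eq0 => h; have : false by apply: h => //; exact: sigma_algebra0.
Qed.

Definition borel_fun (X Y : topologicalType) (g : X -> Y) : Prop :=
  forall A, open A -> <<s @open X >> (g @^-1` A).

Section push_probability.
Context (R : realType) (X Y : topologicalType) (g : X -> Y).
Hypothesis mg : borel_fun g.
Variable mu : borel_probability R X.

Let gB : borelType (bp_point mu) -> borelType (g (bp_point mu)) := g.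

Let measurable_gB : measurable_fun setT gB.
Proof. exact: measurable_borelP. Qed.

HB.instance Definition _ := isMeasurableFun.Build _ _ _ _ gB measurable_gB.

Definition push_probability : borel_probability R Y :=
  BorelProbability (distribution (bp_measure mu) gB).

Lemma push_probabilityE : push_probability = push g mu :> (set Y -> \bar R).
Proof. by []. Qed.

End push_probability.

Lemma pushE (R : realType) (X Y : topologicalType) (g : X -> Y)
  (mu : borel_probability R X) (A : set Y) : push g mu A = mu (g @^-1` A).
Proof. by []. Qed.

Definition dirac_borel (R : realType) (X : topologicalType) (x : X) :
    borel_probability R X :=
  @BorelProbability R X x (@dirac _ (borelType x) x R).

Lemma continuous_borel_fun (X Y : topologicalType) (g : X -> Y) :
  continuous g -> borel_fun g.
Proof.
move=> cg A oA; apply: sub_sigma_algebra.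
by apply: open_comp => // x _; exact: cg.
Qed.

Lemma borel_fun_preimage (X Y : topologicalType) (g : X -> Y) (x0 : X)
    (A : set Y) :
  borel_fun g -> <<s @open Y >> A -> <<s @open X >> (g @^-1` A).
Proof.
move=> bg bA; rewrite -[_ @^-1` _]setTI.
exact: (@measurable_borelP _ (borelType x0) Y (g x0) g bg measurableT A bA).
Qed.

Lemma borel_fun_fst_pair (X Z Y : topologicalType) (x0 : X * Z)
    (phi : X * Z -> Y) :
  @second_countable Y -> borel_fun phi -> borel_fun (fun p => (p.1, phi p)).
Proof.
move=> sY bphi.
apply: (@measurable_pair_preimage _ (borelType x0)) => // A oA.
by apply: continuous_borel_fun oA => ?; exact: cvg_fst.
Qed.

Lemma eq_measure_spt (R : realType) (X : topologicalType)
    (mu : borel_probability R X) (G A B : set X) :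
  @second_countable X -> <<s @open X >> G -> spt mu `<=` G ->
  <<s @open X >> A -> <<s @open X >> B ->
  A `&` G = B `&` G -> mu A = mu B.
Proof.
move=> sX mG sG mA mB AB.
suff muG C : <<s @open X >> C -> mu C = mu (C `&` G) by rewrite muG// AB -muG.
move=> mC; rewrite /bp_fun.
rewrite (@measureDI _ _ _ (bp_measure mu) C G mC mG).
rewrite [X in (X + _)%E](_ : _ = 0%E) ?add0e//.
apply: (@subset_measure0 _ _ _ (bp_measure mu) _ (~` G)).
- exact: measurableD.
- exact: measurableC.
- by move=> x [].
- exact: spt_conull.
Qed.

(** The selection above, applied to the fibers of [D]: the points whose fiber
    meets a closed set [B] form the projection of a closed set, which is closed.
    Off the projection of [D], [phi] is constant. *)
Lemma closed_borel_uniformization (X Y : topologicalType) (D : set (X * Y))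
    (x0 : X) (y0 : Y) :
  compact [set: Y] -> @second_countable Y -> closed D ->
  exists2 phi : X -> Y, borel_fun phi &
    forall x, (fst @` D) x -> D (x, phi x).
Proof.
move=> cY /second_countable_seq[ O Oo Ob] cD.
pose K (x : borelType x0) := [set y | D (x, y)].
have cK x : closed (K x).
  apply: (@preimage_closed _ _ (fun y => (x, y))) => // y _.
  by apply: cvg_pair; [exact: cvg_cst|exact: cvg_id].
have mK B : closed B -> measurable [set x | K x `&` B !=set0].
  move=> cB; apply: closed_measurable_borelType.
  rewrite [X in closed X](_ : _ = fst @` (D `&` snd @^-1` B)).
    apply: closed_fst_image => //; apply: closedI => //.
    by apply: preimage_closed => // q _; exact: cvg_snd.
  apply/seteqP; split=> [x [y [Dxy By]]|_ [[x y] [Dxy By] <-]].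
    by exists (x, y).
  by exists y.
exists (selection K O y0) => [A oA|x [[x' y] Dxy /= <-]].
  by apply: (measurable_selection y0 cY Oo Ob cK mK).
by apply: (@selectionP _ _ _ K O y0) => //; exists y.
Qed.

(** * Continuity of the dynamics *)

Lemma enorm_continuous (R : realType) (n : nat) :
  continuous (@enorm R n).
Proof.
move=> x; rewrite /enorm; apply: (@continuous_comp _ _ _ _ Num.sqrt).
  apply: (@continuous_big _ _ +%R) => [|i _ y]; first exact: add_continuous.
  apply: (@continuous_comp _ _ _ (fun z : 'rV[R]_n => z ord0 i)
    (fun a => a ^+ 2)).
    exact: coord_continuous.
  exact: exprn_continuous.
exact: sqrt_continuous.
Qed.

Lemma ler_coord_enorm (R : realType) (n : nat) (x : 'rV[R]_n) (i : 'I_n) :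
  `|x ord0 i| <= enorm x.
Proof.
rewrite -sqrtr_sqr ler_wsqrtr// (bigD1 i)//= lerDl sumr_ge0// => j _.
exact: sqr_ge0.
Qed.

Lemma lipschitz_dynamics_continuous (R : realType) (n : nat)
    (T : completeMetricType R) (U : set T) (fhat : 'rV[R]_n -> U -> 'rV[R]_n) :
  lipschitz_dynamics fhat -> continuous (fun p => fhat p.1 p.2).
Proof.
move=> [L L0 fL] [x u]; apply/cvg_ballP => e e0 /=.
have eL : 0 < e / L / 2 by rewrite !divr_gt0.
have xN : \forall y \near x, enorm (x - y) < e / L / 2.
  have : (fun y => enorm (x - y)) @ x --> enorm (x - x).
    apply: (@continuous_comp 'rV[R]_n 'rV[R]_n R (fun y => x - y) (@enorm R n) x).
      by apply: (@continuousB _ _ _ (cst x) id) => //; exact: cst_continuous.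
    exact: enorm_continuous.
  have -> : enorm (x - x) = 0.
    by rewrite subrr /enorm big1 ?sqrtr0// => i _; rewrite mxE expr0n.
  move=> /cvgrPdist_lt/(_ _ eL); apply: (@filterS _ _ (nbhs_filter x)) => y.
  by rewrite sub0r normrN ger0_norm// sqrtr_ge0.
have uN : \forall w \near u, mdist (\val u) (\val w) < e / L / 2.
  have := @initial_continuous U T set_val u _ (nbhsx_ballx _ _ eL).
  by apply: (@filterS _ _ (nbhs_filter u)) => w; rewrite /= ballEmdist.
exists ([set y | enorm (x - y) < e / L / 2],
        [set w | mdist (\val u) (\val w) < e / L / 2]) => //.
move=> [y w] [/= xy uw]; split=> // i j; rewrite (ord1 i).
(* The velocity coordinates are those shifted by [n] in the concatenation of
   base point and velocity. *)
have := ler_coord_enorm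
  (row_mx x (fhat x u) - row_mx y (fhat y w)) (rshift n j).
rewrite !mxE -/(lshift _ _) !(unsplitK (inr j)).
move=> /le_lt_trans; apply; apply: le_lt_trans (fL x y u w) _.
by rewrite mulrC -ltr_pdivlMr// [ltRHS]splitr ltrD.
Qed.

(** * The measure control *)

Theorem theorem3 (R : realType) (n : nat)
    (T : completeMetricType R) (sepT : separable T)
    (U : set T) (cU : compact U)
    (fhat : 'rV[R]_n -> U -> 'rV[R]_n)
    (lipf : lipschitz_dynamics fhat)
    (convF : forall x : 'rV[R]_n, convex_set (velocities fhat x))
    (V : borel_probability R 'rV[R]_n -> borel_probability R (tangent R n))
    (mvfV : measure_vector_field V)
    (assV : associated_with fhat V)
    (cptV : forall mu : borel_probability R 'rV[R]_n,
      compactly_supported mu -> compactly_supported (V mu)) :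
  forall r : R, 0 < r ->
  exists u : borel_probability R 'rV[R]_n ->
             borel_probability R ('rV[R]_n * U)%type,
    measure_control u /\
    forall mu : borel_probability R 'rV[R]_n,
      compactly_supported mu -> spt mu `<=` cball0 n r ->
      V mu =b control_vector_field fhat u mu.
Proof.
move=> r r0; have [VE Vfst] := mvfV.
have cptU := compact_set_type cU.
have sU : @second_countable U.
  by apply: second_countable_set_type; exact: separable_second_countable.
have sX := @second_countable_tangent R n.
(* Any probability measure has a nonempty support, so the vector field at a
   Dirac mass already exhibits a control. *)
have [u0 _] : exists u0 : U, True.
  have [p /assV[u _ _]] := spt_neq0 (V (dirac_borel R (0 : 'rV[R]_n))) sX.
  by exists u.
have cfhat := lipschitz_dynamics_continuous lipf.
have cD := closed_fiber (@norm_hausdorff _ 'rV[R]_n) cfhat.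
pose z0 : tangent R n := (0, 0).
have [phi bphi phiP] :=
  @closed_borel_uniformization (tangent R n) U _ z0 u0 cptU sU cD.
pose graph := [set p : tangent R n | velocities fhat p.1 p.2].
have graphE : graph = fst @` [set q : tangent R n * U | fhat q.1.1 q.2 = q.1.2].
  apply/seteqP; split=> [p [u _ up]|_ [[p u] /= up <-]]; last by exists u.
  by exists (p, u).
have cgraph : closed graph by rewrite graphE; exact: closed_fst_image.
have bg := @borel_fun_fst_pair 'rV[R]_n 'rV[R]_n U z0 phi sU bphi.
set g := (fun p => _) in bg.
have bdyn : borel_fun (dynamics fhat).
  apply: continuous_borel_fun; exact: continuous_fst_pair cfhat.
have gK p : graph p -> dynamics fhat (g p) = p.
  move=> Gp; rewrite [RHS]surjective_pairing /dynamics/=; congr pair.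
  by apply: phiP; rewrite -graphE.
exists (fun mu => push_probability bg (V mu)); split; first split.
- move=> mu nu munu A bA.
  rewrite !push_probabilityE !pushE; apply: VE => //.
  exact: borel_fun_preimage.
- move=> mu A bA; rewrite pushE push_probabilityE pushE.
  exact: Vfst.
- move=> mu _ _ A bA.
  rewrite /control_vector_field pushE push_probabilityE pushE.
  apply: (@eq_measure_spt _ _ _ graph) => //.
  + exact: (@closed_measurable_borelType _ z0).
  + by do 2! apply: borel_fun_preimage => //; exact: (0, u0).
  by apply/seteqP; split=> p [] /= Ap Gp; split=> //; move: Ap; rewrite gK.
Qed.
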